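(* For every precomputable quasi-Polish space $\mathbf{X}$, overt choice $\mathrm{VC}_{\mathbf{X}}:\subseteq\mathcal{V}(\mathbf{X})\rightrightarrows\mathbf{X}$ is computable.
   Context: A represented space $\mathbf{X}=(X,\delta_X)$ is a set $X$ with a partial surjection $\delta_X:\subseteq\mathbb{N}^{\mathbb{N}}\to X$. A realizer of a partial multivalued function $f:\subseteq\mathbf{X}\rightrightarrows\mathbf{Y}$ is a partial $F:\subseteq\mathbb{N}^{\mathbb{N}}\to\mathbb{N}^{\mathbb{N}}$ with $\delta_Y(F(p))\in f(\delta_X(p))$ for all $p\in\mathrm{dom}(f\circ\delta_X)$; $f$ is computable if it has a computable realizer. A computable isomorphism is a computable bijection with computable inverse. Sierpinski space $\Sigma$ is $\{\top,\bot\}$ with $\delta_\Sigma(p)=\bot$ iff $p=0^\omega$. $\mathcal{O}(\mathbf{X})$ is the represented space of the open sets $U\subseteq X$ (those open in the final topology of $\delta_X$), each identified with its continuous characteristic function $\chi_U:\mathbf{X}\to\Sigma$ in the function space $\mathcal{C}(\mathbf{X},\Sigma)$ (represented via a universal machine with oracle, so that evaluation and currying are computable). In particular $\mathcal{O}(\mathbb{N})$ is the set of all subsets of $\mathbb{N}$, represented by enumerations. $\mathcal{V}(\mathbf{X})$ is the represented space of closed subsets $A$ of $\mathbf{X}$, where $A$ is identified with $\{U\in\mathcal{O}(\mathbf{X})\mid U\cap A\neq\emptyset\}\in\mathcal{O}(\mathcal{O}(\mathbf{X}))$. Overt choice $\mathrm{VC}_{\mathbf{X}}$ has domain $\{A\in\mathcal{V}(\mathbf{X})\mid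 A\neq\emptyset\}$, and $x\in\mathrm{VC}_{\mathbf{X}}(A)$ iff $x\in A$. For a transitive relation $\prec$ on $\mathbb{N}$, $I\subseteq\mathbb{N}$ is a rounded ideal if (i) $I\neq\emptyset$; (ii) $y\in I$ and $x\prec y$ imply $x\in I$; (iii) for all $x,y\in I$ there is $z\in I$ with $x\prec z$ and $y\prec z$. $\mathrm{RI}(\prec)\subseteq\mathcal{O}(\mathbb{N})$ is the subspace of all rounded ideals (with the restricted representation). $\mathbf{X}$ is a precomputable quasi-Polish space if it is computably isomorphic to $\mathrm{RI}(\prec)$ for some c.e. transitive relation $\prec\ \subseteq\mathbb{N}\times\mathbb{N}$. *)

(* Defs.v *)
From mathcomp Require Import all_boot boolp classical_sets.
From Stdlib Require Cantor.

Set Implicit Arguments.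
Unset Strict Implicit.
Unset Printing Implicit Defensive.

Local Open Scope classical_set_scope.

Definition baire := nat -> nat.

Definition cpair (x y : nat) : nat := Cantor.to_nat (x, y).
Definition cfst (n : nat) : nat := (Cantor.of_nat n).1.
Definition csnd (n : nat) : nat := (Cantor.of_nat n).2.

Lemma cfstK x y : cfst (cpair x y) = x.
Proof. by rewrite /cfst /cpair Cantor.cancel_of_to. Qed.

Lemma csndK x y : csnd (cpair x y) = y.
Proof. by rewrite /csnd /cpair Cantor.cancel_of_to. Qed.

Lemma cpairK n : cpair (cfst n) (csnd n) = n.
Proof.
by rewrite /cfst /csnd /cpair -surjective_pairing Cantor.cancel_to_of.
Qed.

Lemma cpair_inj x y x' y' : cpair x y = cpair x' y' -> x = x' /\ y = y'.
Proof.
by move=> e; rewrite -(cfstK x y) -{2}(csndK x y) e cfstK csndK.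
Qed.

(** Programs for the partial recursive functions relative to an oracle.  All
    functions are unary; several arguments are passed through [cpair]. *)
Inductive code : Type :=
| Zero | Succ | Fst | Snd | Oracle
| Pair of code & code
| Comp of code & code
| Prec of code & code
| Mu of code.

(** [eval a c n m]: program [c] with oracle [a] halts on input [n] with
    output [m].  In [Prec f g], primitive recursion on the second component of
    the input, [s] lists the successive values; [Mu f] is unbounded search, and
    diverges if [f] does before the first zero. *)
Fixpoint eval (a : baire) (c : code) (n m : nat) : Prop :=
  match c with
  | Zero => m = 0
  | Succ => m = n.+1
  | Fst => m = cfst n
  | Snd => m = csnd n
  | Oracle => m = a n
  | Pair f g => exists u v, [/\ eval a f n u, eval a g n v & m = cpair u v]
  | Comp f g => exists2 u, eval a g n u & eval a f u m
  | Prec f g => exists s : nat -> nat,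
      [/\ eval a f (cfst n) (s 0),
          forall i, i < csnd n ->
            eval a g (cpair (cfst n) (cpair i (s i))) (s i.+1)
        & m = s (csnd n)]
  | Mu f => eval a f (cpair n m) 0 /\
      forall i, i < m -> exists v, eval a f (cpair n i) v.+1
  end.

Definition Phi (c : code) (a b : baire) : Prop := forall n, eval a c n (b n).

Fixpoint encode (c : code) : nat :=
  match c with
  | Zero => cpair 0 0
  | Succ => cpair 1 0
  | Fst => cpair 2 0
  | Snd => cpair 3 0
  | Oracle => cpair 4 0
  | Pair f g => cpair 5 (cpair (encode f) (encode g))
  | Comp f g => cpair 6 (cpair (encode f) (encode g))
  | Prec f g => cpair 7 (cpair (encode f) (encode g))
  | Mu f => cpair 8 (encode f)
  end.

Lemma encode_inj : injective encode.
Proof.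
elim=> [|||||f IHf g IHg|f IHf g IHg|f IHf g IHg|f IHf];
  case=> [|||||f' g'|f' g'|f' g'|f'] //= /cpair_inj[] // _.
- by case/cpair_inj=> /IHf-> /IHg->.
- by case/cpair_inj=> /IHf-> /IHg->.
- by case/cpair_inj=> /IHf-> /IHg->.
- by move/IHf->.
Qed.

Lemma eval_det a c n m m' : eval a c n m -> eval a c n m' -> m = m'.
Proof.
elim: c n m m' => [|||||f IHf g IHg|f IHf g IHg|f IHf g IHg|f IHf] n m m' /=;
  try by move=> -> ->.
- move=> [u [v [fu gv ->]]] [u' [v' [fu' gv' ->]]].
  by rewrite (IHf _ _ _ fu fu') (IHg _ _ _ gv gv').
- move=> [u gu fm] [u' gu' fm'].
  by move: fm'; rewrite -(IHg _ _ _ gu gu'); exact: IHf.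
- move=> [s [s0 sS ->]] [s' [s'0 s'S ->]].
  suff: forall i, i <= csnd n -> s i = s' i by apply.
  elim=> [_|i IHi lt_in]; first exact: IHf s0 s'0.
  apply: IHg (sS _ lt_in) _; rewrite (IHi (ltnW lt_in)).
  exact: s'S.
- move=> [fm ltm] [fm' ltm'].
  case: (ltngtP m m') => // lt_mm.
  + by have [v fv] := ltm' _ lt_mm; have := IHf _ _ _ fm fv.
  + by have [v fv] := ltm _ lt_mm; have := IHf _ _ _ fm' fv.
Qed.

Lemma Phi_det c a b b' : Phi c a b -> Phi c a b' -> b = b'.
Proof. by move=> cb cb'; apply/funext => n; exact: eval_det (cb n) (cb' n). Qed.

Definition agree (k : nat) (a b : baire) : Prop := forall i, i < k -> a i = b i.

Lemma agree_le k k' a b : k <= k' -> agree k' a b -> agree k a b.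
Proof. by move=> le_kk h i /leq_trans/(_ le_kk)/h. Qed.

Lemma bounded_use (P : nat -> nat -> Prop) n :
  (forall i k k', k <= k' -> P i k -> P i k') ->
  (forall i, i < n -> exists k, P i k) ->
  exists k, forall i, i < n -> P i k.
Proof.
move=> Pmono; elim: n => [|n IHn] Pex; first by exists 0.
have [k Pk] : exists k, forall i, i < n -> P i k.
  by apply: IHn => i lt_in; apply: Pex; exact: ltnW.
have [k' Pk'] := Pex n (ltnSn n).
exists (maxn k k') => i; rewrite ltnS leq_eqVlt => /predU1P[->|lt_in].
- exact: Pmono (leq_maxr _ _) Pk'.
- exact: Pmono (leq_maxl _ _) (Pk _ lt_in).
Qed.

Lemma eval_use a c n m : eval a c n m ->
  exists k, forall b, agree k a b -> eval b c n m.
Proof.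
elim: c n m => [|||||f IHf g IHg|f IHf g IHg|f IHf g IHg|f IHf] n m /=;
  try by move=> ->; exists 0.
- by move=> ->; exists n.+1 => b ab; apply: ab.
- move=> [u [v [/IHf[k fk] /IHg[k' gk'] ->]]].
  exists (maxn k k') => b ab; exists u, v; split=> //.
  + exact/fk/(agree_le (leq_maxl _ _) ab).
  + exact/gk'/(agree_le (leq_maxr _ _) ab).
- move=> [u /IHg[k gk] /IHf[k' fk']].
  exists (maxn k k') => b ab; exists u.
  + exact/gk/(agree_le (leq_maxl _ _) ab).
  + exact/fk'/(agree_le (leq_maxr _ _) ab).
- move=> [s [/IHf[k fk] sS ->]].
  have [||k' gk'] := @bounded_use (fun i k => forall b, agree k a b ->
      eval b g (cpair (cfst n) (cpair i (s i))) (s i.+1)) (csnd n).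
  + by move=> i j j' le_jj h b /(agree_le le_jj)/h.
  + by move=> i /sS/IHg.
  exists (maxn k k') => b ab; exists s; split=> //.
  + exact/fk/(agree_le (leq_maxl _ _) ab).
  + by move=> i lt_in; apply: (gk' i lt_in); exact: agree_le (leq_maxr _ _) ab.
- move=> [/IHf[k fk] ltm].
  have [||k' gk'] := @bounded_use (fun i k => exists v, forall b, agree k a b ->
      eval b f (cpair n i) v.+1) m.
  + by move=> i j j' le_jj [v h]; exists v => b /(agree_le le_jj)/h.
  + by move=> i /ltm[v /IHf[j h]]; exists j, v.
  exists (maxn k k') => b ab; split.
  + exact/fk/(agree_le (leq_maxl _ _) ab).
  + move=> i /gk'[v h]; exists v.
    exact/h/(agree_le (leq_maxr _ _) ab).
Qed.

Definition computable_point (p : baire) : Prop :=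
  exists c, Phi c (fun=> 0) p.

(** The domain of the machine may be larger than that of [F]. *)
Definition computable_pfun (F : baire -> option baire) : Prop :=
  exists c, forall p q, F p = Some q -> Phi c p q.

(** [names p x] is the graph of the partial surjection delta: delta(p) = x. *)
Record repSpace := RepSpace {
  carrier :> Type;
  names : baire -> carrier -> Prop;
  names_fun : forall p x y, names p x -> names p y -> x = y;
  names_surj : forall x, exists p, names p x
}.
Arguments names : clear implicits.

(** A partial multivalued function is a map to sets; its domain consists of
    the points with nonempty value. *)
Definition realizer (X Y : repSpace) (f : X -> set Y)
    (F : baire -> option baire) : Prop :=
  forall p x, names X p x -> f x !=set0 ->
    exists q y, [/\ F p = Some q, names Y q y & f x y].

Definition computable (X Y : repSpace) (f : X -> set Y) : Prop :=
  exists2 F, realizer f F & computable_pfun F.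

Definition computably_isomorphic (X Y : repSpace) : Prop :=
  exists (f : X -> Y) (g : Y -> X),
    [/\ cancel f g, cancel g f,
        computable (fun x => [set f x]) & computable (fun y => [set g y])].

Section Subspace.
Variables (X : repSpace) (P : set X).

Definition subspace_names (p : baire) (x : {x : X | P x}) : Prop :=
  names X p (sval x).

Fact subspace_names_fun p x y :
  subspace_names p x -> subspace_names p y -> x = y.
Proof. by case: x y => [x Px] [y Py] /= px py; apply/eq_exist/(names_fun px py). Qed.

Fact subspace_names_surj x : exists p, subspace_names p x.
Proof. exact: names_surj. Qed.

Definition subspace : repSpace :=
  RepSpace subspace_names_fun subspace_names_surj.

End Subspace.

(** [true] is top and [false] is bottom. *)
Definition sierp_names (p : baire) (b : bool) : Prop :=
  b = false <-> forall n, p n = 0.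

Fact sierp_names_fun p b b' : sierp_names p b -> sierp_names p b' -> b = b'.
Proof.
rewrite /sierp_names; case: b b' => [] [] // [h1 h2] [h3 h4].
- by have := h2 (h3 erefl).
- by have := h4 (h1 erefl).
Qed.

Fact sierp_names_surj b : exists p, sierp_names p b.
Proof.
by exists (fun=> nat_of_bool b); case: b; split=> // /(_ 0).
Qed.

Definition Sierpinski : repSpace := RepSpace sierp_names_fun sierp_names_surj.

Definition join (p q : baire) : baire :=
  fun n => if odd n then q n./2 else p n./2.

(** The representation of C(X, Y): a name of [f] consists of (the number of) a
    machine followed by an oracle [p 1, p 2, ...], such that the machine with
    this oracle realizes [f]. *)
Definition fun_names (X Y : repSpace) (p : baire) (f : X -> Y) : Prop :=
  exists2 c, p 0 = encode c &
    forall r x, names X r x ->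
      exists2 s, Phi c (join (fun n => p n.+1) r) s & names Y s (f x).

Definition baire_open (W : set baire) : Prop :=
  forall p, W p -> exists k, forall q, agree k p q -> W q.

(** Final topology of the representation: the preimage of [U] is relatively
    open in the set of all names. *)
Definition is_open (X : repSpace) (U : set X) : Prop :=
  exists2 W, baire_open W & forall p x, names X p x -> (U x <-> W p).

Definition is_closed (X : repSpace) (A : set X) : Prop := is_open (~` A).

Definition charf (X : repSpace) (U : set X) : X -> Sierpinski :=
  fun x => `[< U x >].

Lemma charf_names (X : repSpace) (U : set X) p x :
  names Sierpinski p (charf U x) <-> (U x <-> exists n, p n <> 0).
Proof.
rewrite /= /sierp_names /charf; case: asboolP => Ux; split.
- move=> [_ h]; split=> // _; apply: contrapT => /forallNP p0.
  by have // := h (fun n => contrapT (p0 n)).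
- by move=> [/(_ Ux)[n pn] _]; split=> // /(_ n).
- by move=> [/(_ erefl) p0 _]; split=> // -[n]; rewrite p0.
- move=> [_ h]; split=> // _ n; apply: contrapT => pn.
  by apply: Ux; apply: h; exists n.
Qed.

Lemma fun_names_charf_inj (X : repSpace) p (U V : set X) :
  fun_names p (charf U) -> fun_names p (charf V) -> U = V.
Proof.
move=> [c pc hU] [c' pc' hV]; apply/seteqP.
have ecc : c = c' by apply: encode_inj; rewrite -pc -pc'.
have h x : U x <-> V x.
  have [r rx] := names_surj x.
  have [s cs /charf_names sU] := hU r x rx.
  have [s' cs' /charf_names sV] := hV r x rx.
  move: cs' sV; rewrite -ecc => cs' sV.
  by rewrite sU sV (Phi_det cs cs').
by split=> x /h.
Qed.

(** Every open set has a name: the oracle tells which finite words have all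
    their extensions in the open set, and the machine inspects ever longer
    prefixes of its input. *)
Section OpenNames.

Let Id := Pair Fst Snd.
Let Double :=
  Comp (Prec Zero (Comp Succ (Comp Succ (Comp Snd Snd)))) (Pair Zero Id).
Let Prefix :=
  Comp (Prec Zero (Pair (Comp Oracle (Comp Succ (Comp Double (Comp Fst Snd))))
                        (Comp Snd Snd)))
       (Pair Zero Id).
Let Query := Comp Oracle (Comp Double (Pair Id Prefix)).

Fixpoint prefix_code (r : baire) (k : nat) : nat :=
  if k is k'.+1 then cpair (r k') (prefix_code r k') else 0.

Lemma prefix_code_agree r r' k :
  prefix_code r k = prefix_code r' k -> agree k r r'.
Proof.
elim: k => [//|k IHk] /= /cpair_inj[rk /IHk h] i.
by rewrite ltnS leq_eqVlt => /predU1P[->|/h].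
Qed.

Let eval_Id a n : eval a Id n n.
Proof. by exists (cfst n), (csnd n); split=> //; rewrite cpairK. Qed.

Let eval_Zero_Id a n : eval a (Pair Zero Id) n (cpair 0 n).
Proof. by exists 0, n; split=> //; exact: eval_Id. Qed.

Let eval_Double a n : eval a Double n n.*2.
Proof.
exists (cpair 0 n); first exact: eval_Zero_Id.
exists double; rewrite csndK; split=> // i _.
exists i.*2.+1; last by rewrite /= doubleS.
exists i.*2 => //; exists (cpair i i.*2); rewrite /= ?csndK //.
Qed.

Let eval_Prefix q r k : eval (join q r) Prefix k (prefix_code r k).
Proof.
exists (cpair 0 k); first exact: eval_Zero_Id.
exists (prefix_code r); rewrite csndK; split=> // i _.
set w := cpair i _; exists (r i), (prefix_code r i); split=> //.
- exists i.*2.+1; last by rewrite /= /join /= odd_double /= uphalf_double.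
  exists i.*2 => //; exists i; last exact: eval_Double.
  by exists w; rewrite /= ?csndK // /w cfstK.
- by exists w; rewrite /= ?csndK // /w csndK.
Qed.

Let Phi_Query q r :
  Phi Query (join q r) (fun k => q (cpair k (prefix_code r k))).
Proof.
move=> k; set w := cpair k _; exists w.*2; last first.
  by rewrite /= /join odd_double doubleK.
exists w; last exact: eval_Double.
exists k, (prefix_code r k).
by split; [exact: eval_Id|exact: eval_Prefix|].
Qed.

Lemma open_has_name (X : repSpace) (U : set X) :
  is_open U -> exists p, fun_names p (charf U).
Proof.
move=> [W openW UW].
pose good n := forall r, n = cpair (cfst n) (prefix_code r (cfst n)) -> W r.
exists (fun n => if n is n'.+1 then nat_of_bool `[< good n' >] else encode Query).
exists Query => // r x rx.
eexists; first exact: Phi_Query.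
apply/charf_names; rewrite (UW _ _ rx); split.
- move=> /openW[k Wk]; exists k; case: asboolP => // -[] r'.
  by rewrite cfstK => /cpair_inj[_ /prefix_code_agree/Wk].
- by move=> [k]; case: asboolP => // /(_ r); rewrite cfstK => /(_ erefl).
Qed.

End OpenNames.

Section Opens.
Variable X : repSpace.

Definition opens_names (p : baire) (U : {U : set X | is_open U}) : Prop :=
  fun_names p (charf (sval U)).

Fact opens_names_fun p U V : opens_names p U -> opens_names p V -> U = V.
Proof.
case: U V => [U oU] [V oV] pU pV.
exact/eq_exist/(fun_names_charf_inj pU pV).
Qed.

Fact opens_names_surj U : exists p, opens_names p U.
Proof. by case: U => U oU; exact: open_has_name. Qed.

Definition opens : repSpace := RepSpace opens_names_fun opens_names_surj.

End Opens.

Section Overt.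
Variable X : repSpace.

Definition hits (A : set X) : set (opens X) :=
  [set U | sval U `&` A !=set0].

Lemma hits_open (A : set X) : is_open (hits A).
Proof.
exists [set p | exists k, forall q U,
    agree k p q -> names (opens X) q U -> hits A U].
- move=> p [k hk]; exists k => q pq; exists k => q' U qq'.
  by apply: hk => i lt_ik; rewrite (pq i lt_ik) (qq' i lt_ik).
- move=> p U pU; split=> [[x [Ux Ax]]|[k]]; last by apply.
  have [r rx] := names_surj x.
  have [c pc cU] := pU.
  have [s cs /charf_names[/(_ Ux)[n sn] _]] := cU r x rx.
  have [k use] := eval_use (cs n).
  exists k.+1 => q V pq [c' qc' cV]; exists x; split=> //.
  have ecc : c' = c by apply: encode_inj; rewrite -pc -qc' pq.
  have [s' cs' /charf_names sV] := cV r x rx; apply/sV; exists n.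
  rewrite ecc in cs'; suff <- : s n = s' n by [].
  apply: eval_det (cs' n); apply: use => i lt_ik; rewrite /join.
  case: odd => //; apply: pq; rewrite ltnS.
  by apply: leq_ltn_trans lt_ik; rewrite -divn2 leq_div.
Qed.

Lemma hits_inj (A B : set X) :
  is_closed A -> is_closed B -> hits A = hits B -> A = B.
Proof.
suff sub C D : is_closed D -> hits C = hits D -> C `<=` D.
  by move=> cA cB e; apply/seteqP; split; apply: sub.
move=> cD e x Cx; apply: contrapT => nDx.
have : hits C (exist _ (~` D) cD) by exists x.
by rewrite e => -[y []].
Qed.

Definition overt_names (p : baire) (A : {A : set X | is_closed A}) : Prop :=
  names (opens (opens X)) p (exist _ (hits (sval A)) (hits_open (sval A))).

Fact overt_names_fun p A B : overt_names p A -> overt_names p B -> A = B.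
Proof.
case: A B => [A cA] [B cB] pA pB; apply/eq_exist/hits_inj => //.
by have /(congr1 sval) := @names_fun (opens (opens X)) _ _ _ pA pB.
Qed.

Fact overt_names_surj A : exists p, overt_names p A.
Proof. exact: names_surj. Qed.

Definition overt : repSpace := RepSpace overt_names_fun overt_names_surj.

(** Its domain is the set of nonempty [A], by the convention on domains. *)
Definition overt_choice : overt -> set X := fun A => sval A.

End Overt.

(** O(N), represented by enumerations; the value 0 enumerates nothing. *)
Definition enum_names (p : baire) (I : set nat) : Prop :=
  forall n, I n <-> exists k, p k = n.+1.

Fact enum_names_fun p I J : enum_names p I -> enum_names p J -> I = J.
Proof. by move=> pI pJ; apply/seteqP; split=> n => [/pI/pJ|/pJ/pI]. Qed.

Fact enum_names_surj I : exists p, enum_names p I.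
Proof.
exists (fun k => if `[< I k >] then k.+1 else 0) => n; split.
- by move=> In; exists n; rewrite asboolT.
- by move=> [k]; case: asboolP => // Ik [<-].
Qed.

Definition opens_nat : repSpace := RepSpace enum_names_fun enum_names_surj.

Definition rounded_ideal (R : nat -> nat -> Prop) (I : set nat) : Prop :=
  [/\ I !=set0,
      forall x y, I y -> R x y -> I x
    & forall x y, I x -> I y -> exists z, [/\ I z, R x z & R y z]].

Definition RI (R : nat -> nat -> Prop) : repSpace :=
  @subspace opens_nat (rounded_ideal R).

Definition ce_rel (R : nat -> nat -> Prop) : Prop :=
  exists2 e : baire, computable_point e &
    forall x y, R x y <-> exists k, e k = (cpair x y).+1.

Definition precomputable_quasi_Polish (X : repSpace) : Prop :=
  exists R : nat -> nat -> Prop,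
    [/\ ce_rel R, forall x y z, R x y -> R y z -> R x z
      & computably_isomorphic X (RI R)].

(* Main.v *)
(** Let [f] be an isomorphism from [X] onto the rounded ideals of [R], and let
    [U n] be the open set of the [x] with [n] in [f x]; names of the [U n] are
    computable from [n]. A name of an overt set [A] is a machine telling which
    open sets hit [A], so "[U n] hits [A]" becomes semidecidable by running it on
    a universal machine. If [U n] hits [A] in [x], then roundedness of [f x]
    yields [m] with [R n m] such that [U m] hits [A] too; hence a search finds a
    chain [R n0 n1], [R n1 n2], ..., all of whose [U ni] hit [A]. The elements
    below the chain form a rounded ideal. The point it describes is in [A]:
    otherwise, [A] being closed, some [U z] containing that point would miss
    [A], although [R z ni] gives that [U z] contains [U ni]. *)
From mathcomp Require Import all_boot boolp classical_sets.
Require Import Defs.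

Set Implicit Arguments.
Unset Strict Implicit.
Unset Printing Implicit Defensive.

Local Open Scope classical_set_scope.

(** * Oracle substitution and functions computable on a set of oracles *)

Fixpoint subst_oracle (h c : code) : code :=
  match c with
  | Oracle => h
  | Pair f g => Pair (subst_oracle h f) (subst_oracle h g)
  | Comp f g => Comp (subst_oracle h f) (subst_oracle h g)
  | Prec f g => Prec (subst_oracle h f) (subst_oracle h g)
  | Mu f => Mu (subst_oracle h f)
  | c => c
  end.

Lemma eval_subst_oracle h a b c n m :
  Phi h a b -> eval b c n m -> eval a (subst_oracle h c) n m.
Proof.
move=> hab.
elim: c n m => [|||||f IHf g IHg|f IHf g IHg|f IHf g IHg|f IHf] n m //=.
- by move=> ->; exact: hab.
- by move=> [u [v [/IHf fu /IHg gv ->]]]; exists u, v.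
- by move=> [u /IHg gu /IHf fm]; exists u.
- move=> [s [/IHf s0 sS ->]]; exists s; split=> // i /sS; exact: IHg.
- by move=> [/IHf f0 fS]; split=> // i /fS[v /IHf]; exists v.
Qed.

(** One program must serve all oracles in [D]. Partiality is confined to the complement of [D], so
    [F] can be treated as a total function. *)
Definition computable_on (D : set baire) (F : baire -> nat -> nat) : Prop :=
  exists c, forall a, D a -> Phi c a (F a).

(** Classical choice makes unbounded search a total function. Since [g] halts everywhere on the
    oracle [a], [Mu g] meets no divergence before the least zero. *)
Lemma least_zeros (G : baire -> nat -> nat) : exists mu : baire -> nat -> nat,
  forall a n, (exists m, G a (cpair n m) = 0) ->
    G a (cpair n (mu a n)) = 0 /\
    forall g, Phi g a (G a) -> eval a (Mu g) n (mu a n).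
Proof.
suff /choice[mu hmu] : forall an : baire * nat, exists m,
    (exists m, G an.1 (cpair an.2 m) = 0) -> G an.1 (cpair an.2 m) = 0 /\
    forall g, Phi g an.1 (G an.1) -> eval an.1 (Mu g) an.2 m.
  by exists (fun a n => mu (a, n)) => a n /(hmu (a, n)).
move=> [a n] /=; case: (pselect (exists m, G a (cpair n m) = 0)); last by exists 0.
move=> ex; have ex0 : exists m, G a (cpair n m) == 0.
  by have [m /eqP] := ex; exists m.
exists (ex_minn ex0) => _; case: ex_minnP => m /eqP Gm minm; split=> // g hg.
split=> [|i lt_im]; first by rewrite -Gm.
exists (G a (cpair n i)).-1; rewrite prednK ?lt0n; first exact: hg.
by apply: contraTneq lt_im => /eqP/minm; rewrite -leqNgt.
Qed.

Section ComputableOn.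
Variable D : set baire.
Implicit Types F G H K : baire -> nat -> nat.

Lemma eq_computable_on F G :
  (forall a n, F a n = G a n) -> computable_on D F -> computable_on D G.
Proof. by move=> FG [c hc]; exists c => a Da n; rewrite -FG; apply: hc. Qed.

Lemma computable_on_id : computable_on D (fun=> id).
Proof.
by exists (Pair Fst Snd) => a _ n; exists (cfst n), (csnd n); rewrite cpairK.
Qed.

Lemma computable_on_comp F G :
  computable_on D F -> computable_on D G ->
  computable_on D (fun a n => F a (G a n)).
Proof.
move=> [f hf] [g hg]; exists (Comp f g) => a Da n.
by exists (G a n); [exact: hg|exact: hf].
Qed.

Lemma computable_on_pair F G :
  computable_on D F -> computable_on D G ->
  computable_on D (fun a n => cpair (F a n) (G a n)).
Proof.
move=> [f hf] [g hg]; exists (Pair f g) => a Da n.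
by exists (F a n), (G a n); split=> //; [exact: hf|exact: hg].
Qed.

Lemma computable_on_succ F :
  computable_on D F -> computable_on D (fun a n => (F a n).+1).
Proof. by apply: (@computable_on_comp (fun=> succn)); exists Succ. Qed.

Lemma computable_on_const k : computable_on D (fun _ _ => k).
Proof.
by elim: k => [|k IHk]; [exists Zero|exact: computable_on_succ IHk].
Qed.

Lemma computable_on_cfst F :
  computable_on D F -> computable_on D (fun a n => cfst (F a n)).
Proof. by apply: (@computable_on_comp (fun=> cfst)); exists Fst. Qed.

Lemma computable_on_csnd F :
  computable_on D F -> computable_on D (fun a n => csnd (F a n)).
Proof. by apply: (@computable_on_comp (fun=> csnd)); exists Snd. Qed.

Lemma computable_on_oracle F :
  computable_on D F -> computable_on D (fun a n => a (F a n)).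
Proof. by apply: (@computable_on_comp (fun a n => a n)); exists Oracle. Qed.

(** The program for [S] takes parameter, index and previous value packed as [Prec] supplies them.
    Case distinctions and arithmetic are reduced to such iterations below. *)
Lemma computable_on_iteri (S : baire -> nat -> nat -> nat -> nat) F G :
  computable_on D
    (fun a t => S a (cfst t) (cfst (csnd t)) (csnd (csnd t))) ->
  computable_on D F -> computable_on D G ->
  computable_on D (fun a n => iteri (F a n) (S a n) (G a n)).
Proof.
move=> [s hs] hF [g hg].
have [k hk] := computable_on_pair computable_on_id hF.
exists (Comp (Prec g s) k) => a Da n.
exists (cpair n (F a n)); first exact: hk.
exists (fun i => iteri i (S a n) (G a n)).
rewrite cfstK csndK; split=> //=; first exact: hg.
move=> i _; have := hs a Da (cpair n (cpair i (iteri i (S a n) (G a n)))).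
by rewrite !csndK !cfstK.
Qed.

Lemma computable_on_if0 F G H :
  computable_on D F -> computable_on D G -> computable_on D H ->
  computable_on D (fun a n => if F a n == 0 then G a n else H a n).
Proof.
(* The iterated function is constant: zero rounds leave [G a n], any positive number of rounds gives
   [H a n]. *)
move=> hF hG hH; apply: (@eq_computable_on
    (fun a n => iteri (F a n) (fun _ _ => H a n) (G a n))) => [a n|].
  by case: (F a n).
apply: (@computable_on_iteri (fun a n _ _ => H a n)) => //.
exact: computable_on_comp hH (computable_on_cfst computable_on_id).
Qed.

Lemma computable_on_pred F :
  computable_on D F -> computable_on D (fun a n => (F a n).-1).
Proof.
move=> hF; apply: (@eq_computable_on
    (fun a n => iteri (F a n) (fun i _ => i) 0)) => [a n|].
  by case: (F a n).
apply: (@computable_on_iteri (fun _ _ i _ => i)) => //.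
- exact/computable_on_cfst/computable_on_csnd/computable_on_id.
- exact: computable_on_const.
Qed.

Lemma computable_on_sub F G :
  computable_on D F -> computable_on D G ->
  computable_on D (fun a n => F a n - G a n).
Proof.
move=> hF hG; apply: (@eq_computable_on
    (fun a n => iteri (G a n) (fun _ s => s.-1) (F a n))) => [a n|].
  by elim: (G a n) => [|k IHk]; rewrite ?subn0 //= IHk subnS.
apply: (@computable_on_iteri (fun _ _ _ s => s.-1)) => //.
exact/computable_on_pred/computable_on_csnd/computable_on_csnd/computable_on_id.
Qed.

Lemma computable_on_ifeq F G H K :
  computable_on D F -> computable_on D G ->
  computable_on D H -> computable_on D K ->
  computable_on D (fun a n => if F a n == G a n then H a n else K a n).
Proof.
move=> hF hG hH hK.
have hFG := computable_on_sub hF hG; have hGF := computable_on_sub hG hF.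
apply: eq_computable_on (computable_on_if0 hFG (computable_on_if0 hGF hH hK) hK).
by move=> a n; rewrite !subn_eq0 eqn_leq; case: leqP => //; case: leqP.
Qed.

Lemma computable_on_odd F :
  computable_on D F -> computable_on D (fun a n => odd (F a n)).
Proof.
move=> hF; apply: (@eq_computable_on (fun a n =>
    iteri (F a n) (fun _ s => if s == 0 then 1 else 0) 0)) => [a n|].
  by elim: (F a n) => //= k ->; case: odd.
apply: (@computable_on_iteri (fun _ _ _ s => if s == 0 then 1 else 0)) => //.
- apply: computable_on_if0; try exact: computable_on_const.
  exact/computable_on_csnd/computable_on_csnd/computable_on_id.
- exact: computable_on_const.
Qed.

Lemma computable_on_half F :
  computable_on D F -> computable_on D (fun a n => (F a n)./2).
Proof.
move=> hF; apply: (@eq_computable_on (fun a n => iteri (F a n)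
    (fun i s => if nat_of_bool (odd i) == 0 then s else s.+1) 0)) => [a n|].
  by elim: (F a n) => //= k ->; rewrite uphalf_half; case: odd.
apply: (@computable_on_iteri
    (fun _ _ i s => if nat_of_bool (odd i) == 0 then s else s.+1)) => //.
- have hs := computable_on_csnd (computable_on_csnd computable_on_id).
  apply: computable_on_if0 => //; last exact: computable_on_succ.
  exact/computable_on_odd/computable_on_cfst/computable_on_csnd/computable_on_id.
- exact: computable_on_const.
Qed.

Lemma computable_on_double F :
  computable_on D F -> computable_on D (fun a n => (F a n).*2).
Proof.
move=> hF; apply: (@eq_computable_on (fun a n =>
    iteri (F a n) (fun _ s => s.+2) 0)) => [a n|].
  by elim: (F a n) => //= k ->.
apply: (@computable_on_iteri (fun _ _ _ s => s.+2)) => //.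
- apply/computable_on_succ/computable_on_succ.
  exact/computable_on_csnd/computable_on_csnd/computable_on_id.
- exact: computable_on_const.
Qed.

Lemma computable_on_point e : computable_point e -> computable_on D (fun=> e).
Proof.
move=> [c hc]; exists (subst_oracle Zero c) => a _ n.
exact: eval_subst_oracle (hc n).
Qed.

Lemma computable_on_subst (E : set baire) (T : baire -> baire) F :
  computable_on E F -> computable_on D T -> (forall a, D a -> E (T a)) ->
  computable_on D (fun a => F (T a)).
Proof.
move=> [f hf] [t ht] DE; exists (subst_oracle t f) => a Da n.
exact: eval_subst_oracle (ht a Da) (hf _ (DE a Da) n).
Qed.

(** On [D] the value is always [Some], so the default sequence is never taken there. *)
Lemma computable_on_pfun (T : baire -> option baire) :
  computable_pfun T -> (forall a, D a -> T a) ->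
  computable_on D (fun a => odflt (fun=> 0) (T a)).
Proof.
by move=> [c hc] DT; exists c => a /DT; case Ta: (T a) => [q|//] _; apply: hc.
Qed.

(** The least zero of [G a (cpair s -)] is only required to exist for [s] in
    the invariant [P a], which the iteration maintains. *)
Lemma computable_on_chain (P : baire -> nat -> Prop) F G :
  computable_on D F -> computable_on D G ->
  (forall a, D a -> forall n, P a (F a n)) ->
  (forall a, D a -> forall s, P a s -> exists m, G a (cpair s m) = 0) ->
  (forall a, D a -> forall s m, P a s -> G a (cpair s m) = 0 -> P a m) ->
  exists K, computable_on D K /\ forall a, D a ->
    P a (K a 0) /\ forall i, G a (cpair (K a i) (K a i.+1)) = 0.
Proof.
move=> [f hf] [g hg] PF Pex Pstep; have [mu hmu] := least_zeros G.
pose K a i := iter i (mu a) (F a 0).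
have KP a i : D a -> P a (K a i).
  move=> Da; elim: i => [|i Pi]; first exact: PF.
  by case: (hmu _ _ (Pex a Da _ Pi)) => /(Pstep a Da _ _ Pi).
exists K; split=> [|a Da]; last first.
  by split=> [|i]; [exact: (KP a 0)|case: (hmu _ _ (Pex a Da _ (KP a i Da)))].
(* Primitive recursion with dummy parameter 0, whose step searches from the previous value. *)
exists (Comp (Prec (Comp f Zero) (Comp (Mu g) (Comp Snd Snd)))
             (Pair Zero (Pair Fst Snd))) => a Da n.
exists (cpair 0 n).
  by exists 0, n; split=> //; exists (cfst n), (csnd n); rewrite cpairK.
exists (K a); rewrite csndK; split=> //; first by exists 0 => //; exact: hf.
move=> i _; exists (K a i).
  by exists (cpair i (K a i)); rewrite /= !csndK.
by have [_] := hmu _ _ (Pex a Da _ (KP a i Da)); apply; exact: hg.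
Qed.

Lemma computable_on_mu G :
  computable_on D G ->
  (forall a, D a -> forall n, exists m, G a (cpair n m) = 0) ->
  exists K, computable_on D K /\ forall a, D a ->
    forall n, G a (cpair n (K a n)) = 0.
Proof.
move=> [g hg] Gex; have [mu hmu] := least_zeros G.
exists mu; split=> [|a Da n]; last by case: (hmu a n (Gex a Da n)).
exists (Mu g) => a Da n.
by have [_] := hmu a n (Gex a Da n); apply; exact: hg.
Qed.

End ComputableOn.

Ltac prove_computable_on :=
  repeat first
    [ assumption | exact: computable_on_id | exact: computable_on_const
    | apply: computable_on_cfst | apply: computable_on_csnd
    | apply: computable_on_pair | apply: computable_on_if0
    | apply: computable_on_ifeq | apply: computable_on_succ
    | apply: computable_on_pred | apply: computable_on_odd
    | apply: computable_on_half | apply: computable_on_double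
    | apply: computable_on_oracle ].

(** * A universal oracle machine *)

(** A stack machine executing all codes. A state either asks to evaluate the
    code numbered [c] on [n], or returns a value [v]; the rest of it is a list
    of tagged continuations: 0 and 1 for the components of a pair, 2 for
    composition, 3 for primitive recursion and 4 for unbounded search. *)
Definition eval_state (c n stack : nat) : nat := cpair 0 (cpair c (cpair n stack)).
Definition return_state (v stack : nat) : nat := cpair 1 (cpair v stack).
(** The successor keeps nonempty stacks distinct from the empty stack 0. *)
Definition push (tag data stack : nat) : nat := (cpair (cpair tag data) stack).+1.

Definition eval_step (b : baire) (c n k : nat) : nat :=
  let: (tag, f, g) := (cfst c, cfst (csnd c), csnd (csnd c)) in
  if tag == 0 then return_state 0 k
  else if tag == 1 then return_state n.+1 k
  else if tag == 2 then return_state (cfst n) k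
  else if tag == 3 then return_state (csnd n) k
  else if tag == 4 then return_state (b n) k
  else if tag == 5 then eval_state f n (push 0 (cpair g n) k)
  else if tag == 6 then eval_state g n (push 2 f k)
  else if tag == 7 then eval_state f (cfst n)
    (push 3 (cpair g (cpair (cfst n) (cpair 0 (csnd n)))) k)
  else eval_state (csnd c) (cpair n 0)
    (push 4 (cpair (csnd c) (cpair n 0)) k).

Definition return_step (v k : nat) : nat :=
  if k == 0 then return_state v 0 else
  let: (tag, d, k') := (cfst (cfst k.-1), csnd (cfst k.-1), csnd k.-1) in
  if tag == 0 then eval_state (cfst d) (csnd d) (push 1 v k')
  else if tag == 1 then return_state (cpair d v) k'
  else if tag == 2 then eval_state d v k'
  else if tag == 3 then
    let: (g, a, i, n) := (cfst d, cfst (csnd d), cfst (csnd (csnd d)),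
                          csnd (csnd (csnd d))) in
    if i == n then return_state v k'
    else eval_state g (cpair a (cpair i v))
           (push 3 (cpair g (cpair a (cpair i.+1 n))) k')
  else
    let: (f, n, i) := (cfst d, cfst (csnd d), csnd (csnd d)) in
    if v == 0 then return_state i k'
    else eval_state f (cpair n i.+1) (push 4 (cpair f (cpair n i.+1)) k').

Definition step (b : baire) (s : nat) : nat :=
  if cfst s == 0
  then eval_step b (cfst (csnd s)) (cfst (csnd (csnd s))) (csnd (csnd (csnd s)))
  else return_step (cfst (csnd s)) (csnd (csnd s)).

Lemma step_eval_state b c n k : step b (eval_state c n k) = eval_step b c n k.
Proof. by rewrite /step /eval_state !(cfstK, csndK). Qed.

Lemma step_return_state b v k : step b (return_state v k) = return_step v k.
Proof. by rewrite /step /return_state !(cfstK, csndK). Qed.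

Definition steps (b : baire) (s s' : nat) : Prop :=
  exists j, iter j (step b) s = s'.

Lemma steps_trans b s1 s2 s3 : steps b s1 s2 -> steps b s2 s3 -> steps b s1 s3.
Proof. by move=> [i <-] [j <-]; exists (j + i); rewrite iterD. Qed.

Lemma steps_step b s s' : steps b (step b s) s' -> steps b s s'.
Proof. by move=> [i <-]; exists i.+1; rewrite iterSr. Qed.

(** Induction on the code; the stack [k] is arbitrary because subprograms run on top of pending
    continuations. *)
Lemma steps_eval b c n m k : eval b c n m ->
  steps b (eval_state (encode c) n k) (return_state m k).
Proof.
elim: c n m k => [|||||f IHf g IHg|f IHf g IHg|f IHf g IHg|f IHf] n m k /=;
  try by move=> ->; exists 1; rewrite /= step_eval_state /eval_step !(cfstK, csndK).
- move=> [u [v [fu gv ->]]]; apply: steps_step.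
  rewrite step_eval_state /eval_step !(cfstK, csndK) /=.
  apply: steps_trans (IHf _ _ _ fu) _; apply: steps_step.
  rewrite step_return_state /return_step /= !(cfstK, csndK) /=.
  apply: steps_trans (IHg _ _ _ gv) _; apply: steps_step.
  by rewrite step_return_state /return_step /= !(cfstK, csndK) /=; exists 0.
- move=> [u gu fm]; apply: steps_step.
  rewrite step_eval_state /eval_step !(cfstK, csndK) /=.
  apply: steps_trans (IHg _ _ _ gu) _; apply: steps_step.
  rewrite step_return_state /return_step /= !(cfstK, csndK) /=.
  exact: IHf.
- move=> [s [s0 sS ->]]; apply: steps_step.
  rewrite step_eval_state /eval_step !(cfstK, csndK) /=.
  apply: steps_trans (IHf _ _ _ s0) _.
  (* Loop invariant: the value [s i] is returned to the frame of round [i]; the induction is on the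
     number [j] of remaining rounds. *)
  suff loop j i : i + j = csnd n -> steps b (return_state (s i)
      (push 3 (cpair (encode g) (cpair (cfst n) (cpair i (csnd n)))) k))
      (return_state (s (csnd n)) k) by exact: (loop (csnd n)).
  elim: j i => [|j IHj] i eij; apply: steps_step;
    rewrite step_return_state /return_step /= !(cfstK, csndK) /=.
    by rewrite -eij addn0 eqxx; exists 0.
  have lt_in : i < csnd n by rewrite -eij addnS ltnS leq_addr.
  rewrite ltn_eqF //; apply: steps_trans (IHg _ _ _ (sS i lt_in)) _.
  by apply: IHj; rewrite addSnnS.
- move=> [f0 fS]; apply: steps_step.
  rewrite step_eval_state /eval_step !(cfstK, csndK) /=.
  suff loop j i : i + j = m -> steps b
      (eval_state (encode f) (cpair n i) (push 4 (cpair (encode f) (cpair n i)) k))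
      (return_state m k) by exact: (loop m).
  elim: j i => [|j IHj] i eij.
    apply: steps_trans (IHf _ 0 _ _) _; first by rewrite -(addn0 i) eij.
    apply: steps_step; rewrite step_return_state /return_step /= !(cfstK, csndK) /=.
    by rewrite -eij addn0; exists 0.
  have [|v fv] := fS i; first by rewrite -eij addnS ltnS leq_addr.
  apply: steps_trans (IHf _ _ _ fv) _; apply: steps_step.
  rewrite step_return_state /return_step /= !(cfstK, csndK) /=.
  by apply: IHj; rewrite addSnnS.
Qed.

Lemma iter_step_halted b v j :
  iter j (step b) (return_state v 0) = return_state v 0.
Proof. by elim: j => //= j ->; rewrite step_return_state. Qed.

(** Halted states are fixed points of [step], so both runs can be prolonged to the same length. *)
Lemma steps_return_unique b s v v' :
  steps b s (return_state v 0) -> steps b s (return_state v' 0) -> v = v'.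
Proof.
move=> [j ej] [j' ej'].
have : iter (j' + j) (step b) s = iter (j + j') (step b) s by rewrite addnC.
rewrite !iterD ej ej' !iter_step_halted.
by move=> /cpair_inj[_ /cpair_inj[]].
Qed.

Section Universal.
Variables (D : set baire) (b : baire -> nat -> baire).
Hypothesis b_computable : computable_on D (fun a t => b a (cfst t) (csnd t)).

Lemma computable_on_step S W :
  computable_on D S -> computable_on D W ->
  computable_on D (fun a n => step (b a (W a n)) (S a n)).
Proof.
move=> hS hW.
have hb N : computable_on D N -> computable_on D (fun a n => b a (W a n) (N a n)).
  move=> hN; have := computable_on_comp b_computable (computable_on_pair hW hN).
  by apply: eq_computable_on => a n; rewrite cfstK csndK.
rewrite /step /eval_step /return_step /eval_state /return_state /push.
prove_computable_on; apply: hb; prove_computable_on.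
Qed.

(** Program, input and index of the oracle may all vary with [n]. Halting is assumed for every [n],
    so a search for the number of steps succeeds and yields a total [V]. *)
Lemma universal_computable_on C N W :
  computable_on D C -> computable_on D N -> computable_on D W ->
  (forall a, D a -> forall n, exists c m,
     C a n = encode c /\ eval (b a (W a n)) c (N a n) m) ->
  exists V, computable_on D V /\ forall a, D a -> forall n c m,
    C a n = encode c -> eval (b a (W a n)) c (N a n) m -> V a n = m.
Proof.
move=> hC hN hW CN.
pose st a n j := iter j (step (b a (W a n))) (eval_state (C a n) (N a n) 0).
have hst N' J : computable_on D N' -> computable_on D J ->
    computable_on D (fun a n => st a (N' a n) (J a n)).
  move=> hN' hJ; apply: (@eq_computable_on _ (fun a n => iteri (J a n)
      (fun _ s => step (b a (W a (N' a n))) s)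
      (eval_state (C a (N' a n)) (N a (N' a n)) 0))) => [a n|].
    by rewrite /st; elim: (J a n) => //= j ->.
  apply: (@computable_on_iteri _ (fun a n _ s => step (b a (W a (N' a n))) s)) => //.
    apply: computable_on_step; prove_computable_on.
    apply: computable_on_comp hW _; apply: (computable_on_comp hN').
    prove_computable_on.
  rewrite /eval_state; prove_computable_on.
    exact: computable_on_comp hC hN'.
  exact: computable_on_comp hN hN'.
(* [G] vanishes exactly when the state reached is a return state (tag 1) with empty stack. *)
pose G a t := let s := st a (cfst t) (csnd t) in
  if cfst s == 1 then csnd (csnd s) else 1.
have [||K [hK GK]] := @computable_on_mu D G.
- rewrite /G; have := hst (fun=> cfst) (fun=> csnd).
  by move=> h; prove_computable_on; apply: h; prove_computable_on.
- move=> a Da n; have [c [m [ec cm]]] := CN a Da n.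
  have [j ej] := steps_eval 0 cm.
  by exists j; rewrite /G cfstK csndK /st ec ej /return_state !(cfstK, csndK).
exists (fun a n => cfst (csnd (st a n (K a n)))); split.
  prove_computable_on; apply: hst => //; prove_computable_on.
move=> a Da n c m ec cm; have := GK a Da n; rewrite /G cfstK csndK.
set s := st a n (K a n); case: eqP => // s1 s0.
apply: steps_return_unique (steps_eval 0 cm).
by exists (K a n); rewrite -ec -/(st a n (K a n)) -/s -[s in LHS]cpairK s1
  -[csnd s in LHS]cpairK s0.
Qed.

End Universal.

(** * Realizers, open sets and semidecision procedures *)

Definition named (X : repSpace) : set baire := [set p | exists x, names X p x].

Lemma computable_fun_realizer (X Y : repSpace) (f : X -> Y) :
  computable (fun x => [set f x]) ->
  exists T : baire -> baire, computable_on (named X) T /\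
    forall p x, names X p x -> names Y (T p) (f x).
Proof.
move=> [F rF cF].
have FT p x : names X p x ->
    exists2 q, F p = Some q & names Y q (f x).
  move=> px; have [|q [y [Fp qy <-]]] := rF p x px; last by exists q.
  by exists (f x).
exists (fun p => odflt (fun=> 0) (F p)); split.
  by apply: computable_on_pfun => // p [x /FT[q ->]].
by move=> p x /FT[q ->].
Qed.

(** Computable maps are continuous, because a halting computation uses a finite part of its
    oracle. *)
Lemma open_preimage (X Y : repSpace) (f : X -> Y) (U : set Y) :
  computable (fun x => [set f x]) -> is_open U -> is_open (f @^-1` U).
Proof.
move=> /computable_fun_realizer[T [[c hc] Tf]] [W openW UW].
(* As [T] is controlled on names only, the open set is described by [eval]: the program outputs a
   finite word all of whose extensions lie in [W]. *)
exists [set p | exists (q : baire) k, (forall i, i < k -> eval p c i (q i)) /\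
    forall q', agree k q q' -> W q'].
  move=> p [q [k [pq qW]]].
  have [||j hj] := @bounded_use
    (fun i j => forall p', agree j p p' -> eval p' c i (q i)) k.
  - by move=> i j j' le_jj h p' /(agree_le le_jj)/h.
  - by move=> i /pq/eval_use.
  by exists j => p' pp'; exists q, k; split=> // i /hj; apply.
move=> p x px; have Tpx := hc p (ex_intro _ x px).
rewrite /preimage /= (UW _ _ (Tf _ _ px)); split.
  by move=> /openW[k kW]; exists (T p), k.
by move=> [q [k [pq]]]; apply=> i /pq h; exact: eval_det h (Tpx i).
Qed.

(** A nonzero output is observed after finitely many oracle queries. This lets a set given by a name
    be used as a point of [opens X]. *)
Lemma fun_names_open (X : repSpace) p (U : set X) :
  fun_names p (charf U) -> is_open U.
Proof.
move=> [c _ cU]; pose o (r : baire) := join (fun n => p n.+1) r.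
exists [set r | exists n v, eval (o r) c n v.+1].
  move=> r [n [v /eval_use[k hk]]]; exists k => r' rr'; exists n, v.
  apply: hk => i lt_ik; rewrite /o /join; case: odd => //; apply: rr'.
  by apply: leq_ltn_trans lt_ik; rewrite -divn2 leq_div.
move=> r x rx; have [s cs /charf_names ->] := cU r x rx; split.
  move=> [n /eqP sn]; exists n, (s n).-1.
  by rewrite prednK ?lt0n.
by move=> [n [v nv]]; exists n; rewrite (eval_det (cs n) nv).
Qed.

(** The machine [d] is the same for all [n], which enters through the constant oracle [n.+1]; [d]
    looks for [n.+1] in the enumeration [T r]. *)
Lemma semidecide_mem (X : repSpace) (N : X -> set nat) (T : baire -> baire) :
  computable_on (named X) T ->
  (forall r x, names X r x -> enum_names (T r) (N x)) ->
  exists d, forall n r x, names X r x ->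
    exists2 s, Phi d (join (fun=> n.+1) r) s &
      names Sierpinski s (charf [set y | N y n] x).
Proof.
move=> hT TN.
(* In a joined oracle the odd positions hold the name of the point, and position 0 holds [n.+1]. *)
pose D := [set b : baire | named X (fun i => b i.*2.+1)].
have [d hd] : computable_on D (fun b k =>
    if T (fun i => b i.*2.+1) k == b 0 then 1 else 0).
  have hT' : computable_on D (fun b => T (fun i => b i.*2.+1)).
    apply: (@computable_on_subst _ _ (fun b i => b i.*2.+1) _ hT) => //.
    by prove_computable_on.
  by apply: computable_on_ifeq => //; prove_computable_on.
exists d => n r x rx.
have er : (fun i => join (fun=> n.+1) r i.*2.+1) = r.
  by apply/funext => i; rewrite /join /= odd_double /= uphalf_double.
exists (fun k => if T r k == n.+1 then 1 else 0).
  have Dr : D (join (fun=> n.+1) r) by rewrite /D /= er; exists x.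
  by move=> k; have := hd _ Dr k; rewrite er.
apply/charf_names; rewrite /= (TN r x rx n).
by split=> -[k rk]; exists k; [rewrite rk eqxx|move: rk; case: eqP].
Qed.

(** By hypothesis a name of an overt set yields a machine that is total on the
    names [r n], so the universal machine may simply run it. *)
Lemma semidecide_hits (X : repSpace) (U : nat -> set X) (r : nat -> baire) :
  (forall n, fun_names (r n) (charf (U n))) ->
  (forall D, computable_on D (fun _ t => r (cfst t) (csnd t))) ->
  exists V, computable_on (named (overt X)) V /\
    forall p (A : overt X), names (overt X) p A -> forall n,
      (exists k, V p (cpair n k) <> 0) <-> U n `&` sval A !=set0.
Proof.
move=> rU hr; pose b (p : baire) w := join (fun i => p i.+1) (r w).
have hb : computable_on (named (overt X)) (fun p t => b p (cfst t) (csnd t)).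
  rewrite /b /join; apply: (@eq_computable_on _ (fun p t =>
      if nat_of_bool (odd (csnd t)) == 0 then p (csnd t)./2.+1
      else r (cfst t) (csnd t)./2)) => [p t|]; first by case: odd.
  apply: computable_on_if0; prove_computable_on.
  have := computable_on_comp (hr (named (overt X)))
    (computable_on_pair (computable_on_cfst (computable_on_id _))
      (computable_on_half (computable_on_csnd (computable_on_id _)))).
  by apply: eq_computable_on => p t; rewrite cfstK csndK.
have pA p (A : overt X) : names (overt X) p A -> exists2 c, p 0 = encode c &
    forall n, exists2 s, Phi c (b p n) s &
      (U n `&` sval A !=set0 <-> exists k, s k <> 0).
  move=> [c pc cA]; exists c => // n.
  have [s cs /charf_names sA] := cA (r n)
    (exist _ (U n) (fun_names_open (rU n)) : opens X) (rU n).
  by exists s.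
(* An input [cpair n k] asks for output [k] of the machine of [p] run on the name [r n]. *)
have [||||V [hV VE]] := @universal_computable_on _ b hb
    (fun p _ => p 0) (fun=> csnd) (fun=> cfst).
- by prove_computable_on.
- by prove_computable_on.
- by prove_computable_on.
- move=> p [A /pA[c pc cA]] n; have [s cs _] := cA (cfst n).
  by exists c, (s (csnd n)).
exists V; split=> // p A pA' n; have [c pc cA] := pA p A pA'.
have [s cs ->] := cA n.
have Vs k : V p (cpair n k) = s k.
  apply: (VE p _ _ c) => //; first by exists A.
  by rewrite cfstK csndK.
by split=> -[k Vk]; exists k; move: Vk; rewrite Vs.
Qed.

(** * Rounded ideals and their topology *)

(** Two elements below the chain lie below a common [s m], which is itself below [s m.+1]. *)
Lemma chain_rounded_ideal (R : nat -> nat -> Prop) (s : nat -> nat) :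
  (forall x y z, R x y -> R y z -> R x z) ->
  (forall i, R (s i) (s i.+1)) ->
  rounded_ideal R [set x | exists i, R x (s i)].
Proof.
move=> Rtr Rs.
have Rs_le x i j : i <= j -> R x (s i) -> R x (s j).
  move=> /subnKC <-; elim: (j - i) => [|k IHk]; first by rewrite addn0.
  by move=> /IHk h; rewrite addnS; apply: Rtr (Rs _).
split.
- by exists (s 0), 1.
- by move=> x y [i yi] xy; exists i; exact: Rtr yi.
- move=> x y [i xi] [j yj]; exists (s (maxn i j)); split.
  + by exists (maxn i j).+1.
  + exact: Rs_le (leq_maxl _ _) xi.
  + exact: Rs_le (leq_maxr _ _) yj.
Qed.

(** A prefix of a name of [I] already forces membership in [V]. It lists finitely many elements of
    [I], and roundedness gives a [z] in [I] above all of them. *)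
Lemma RI_open_basis (R : nat -> nat -> Prop) (V : set (RI R)) (I : RI R) :
  (forall x y z, R x y -> R y z -> R x z) -> is_open V -> V I ->
  exists z, sval I z /\ forall J : RI R, sval J z -> V J.
Proof.
move=> Rtr [W openW VW] VI; have [q qI] := names_surj I.
have [k qk] := openW q (iffLR (VW q I qI) VI).
have [z [Iz zub]] : exists z, sval I z /\
    forall i y, i < k -> q i = y.+1 -> R y z.
  have [[z0 Iz0] _ dir] := svalP I; elim: k {qk} => [|k [z [Iz zub]]].
    by exists z0.
  case qk: (q k) => [|y].
    exists z; split=> // i y; rewrite ltnS leq_eqVlt => /predU1P[->|]; last exact: zub.
    by rewrite qk.
  have Iy : sval I y by apply/(qI y); exists k.
  have [z' [Iz' zz' yz']] := dir z y Iz Iy.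
  exists z'; split=> // i y'; rewrite ltnS leq_eqVlt => /predU1P[->|lt_ik].
    by rewrite qk => -[<-].
  by move=> /(zub _ _ lt_ik) y'z; exact: Rtr zz'.
exists z; split=> // J Jz; have [r rJ] := names_surj J.
have [_ Jdown _] := svalP J.
(* The prefix of [q] lists only elements below [z], hence in [J], so it may be prepended to a name
   of [J]. *)
pose q' i := if i < k then q i else r (i - k).
have q'J : names (RI R) q' J.
  move=> n; rewrite (rJ n) /q'; split=> -[i].
    by exists (k + i); rewrite ltnNge leq_addr addKn.
  case: ifP => [lt_ik qi|_]; last by exists (i - k).
  by apply/(rJ n); apply: Jdown Jz _; exact: zub qi.
by apply/(VW _ _ q'J); apply: qk => i lt_ik; rewrite /q' lt_ik.
Qed.

(** * Overt choice *)

Theorem theorem20 (X : repSpace) (hX : precomputable_quasi_Polish X) :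
  computable (@overt_choice X).
Proof.
have [R [[e he eR] Rtr [f [g [fK _ hf hg]]]]] := hX.
have [Tf [hTf Tf_names]] := computable_fun_realizer hf.
have [Tg [hTg Tg_names]] := computable_fun_realizer hg.
pose U n : set X := [set x | sval (f x) n].
have [d hd] := semidecide_mem (N := fun x => sval (f x)) hTf Tf_names.
pose r n i := if i == 0 then encode d else n.+1.
have rU n : fun_names (r n) (charf (U n)) by exists d => // t x; exact: hd.
have hr D : computable_on D (fun _ t => r (cfst t) (csnd t)).
  by rewrite /r; prove_computable_on.
have [V [[v hv] VA]] := semidecide_hits rU hr.
pose D := [set p | exists2 A : overt X, names (overt X) p A & sval A !=set0].
have hV : computable_on D V by exists v => p [A pA _]; apply: hv; exists A.
have he' : computable_on D (fun=> e) by exact: computable_on_point.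
(* Search for a start [cpair n0 k], where output [k] witnesses that [U n0] hits the set. *)
pose G0 (p : baire) t := if V p (csnd t) == 0 then 1 else 0.
have [||F0 [hF0 F0E]] := @computable_on_mu D G0.
- rewrite /G0; prove_computable_on; apply: (computable_on_comp hV).
  by prove_computable_on.
- move=> p [A pA [x Ax]] i; have [[n0 In0] _ _] := svalP (f x).
  have [k /eqP/negPf Vk] := iffRL (VA p A pA n0) (ex_intro _ x (conj In0 Ax)).
  by exists (cpair n0 k); rewrite /G0 csndK Vk.
pose hit p n := exists k, V p (cpair n k) <> 0.
(* The next state is [cpair z (cpair k j)]: [k] witnesses that [U z] hits the set, and [j] is a
   place where [e] lists the previous element as related to [z]. *)
pose G (p : baire) t := let m := csnd t in
  if V p (cpair (cfst m) (cfst (csnd m))) == 0 then 1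
  else if e (csnd (csnd m)) == (cpair (cfst (cfst t)) (cfst m)).+1
  then 0 else 1.
have [||||K [hK KE]] :=
  @computable_on_chain D (fun p s => hit p (cfst s)) F0 G hF0.
- rewrite /G; prove_computable_on.
  + by apply: (computable_on_comp hV); prove_computable_on.
  + by apply: (computable_on_comp he'); prove_computable_on.
- move=> p Dp n; exists (csnd (F0 p n)); have := F0E p Dp n.
  by rewrite /G0 csndK cpairK; case: eqP.
- move=> p [A pA _] s /(VA p A pA)[x [Ix Ax]].
  (* Directedness applied to an element paired with itself gives [z] in [f x] strictly further along
     [R]. *)
  have [_ _ /(_ _ _ Ix Ix)[z [Iz sz _]]] := svalP (f x).
  have [k /eqP/negPf Vk] := iffRL (VA p A pA z) (ex_intro _ x (conj Iz Ax)).
  have [j ej] := iffLR (eR _ _) sz.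
  exists (cpair z (cpair k j)).
  by rewrite /G !(cfstK, csndK) Vk ej eqxx.
- move=> p _ s m _; rewrite /G !(cfstK, csndK); case: eqP => // Vm _.
  by exists (cfst (csnd m)).
pose n p i := cfst (K p i).
have nE p i : D p -> hit p (n p i) /\ R (n p i) (n p i.+1).
  move=> Dp; have [hit0 /= KS] := KE p Dp.
  have := KS i; rewrite /G !(cfstK, csndK); case: eqP => // _.
  case: eqP => // ej _; split; last by apply/eR; eexists; exact: ej.
  (* The start hits by the invariant; each later state carries its own witness. *)
  case: i {ej} => [//|i]; have := KS i; rewrite /G !(cfstK, csndK).
  by case: eqP => // Vm _; exists (cfst (csnd (K p i.+1))).
(* At [cpair j i], the pair listed by [e] at [j] contributes its first component if its second is
   [n p i]; otherwise 0 enumerates nothing. *)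
pose Q p t := if e (cfst t) == 0 then 0
  else if csnd (e (cfst t)).-1 == n p (csnd t)
  then (cfst (e (cfst t)).-1).+1 else 0.
have hQ : computable_on D Q.
  have hec : computable_on D (fun _ t => e (cfst t)).
    by apply: (computable_on_comp he'); prove_computable_on.
  rewrite /Q /n; prove_computable_on.
  by apply: (computable_on_comp hK); prove_computable_on.
have nI p : D p -> rounded_ideal R [set x | exists i, R x (n p i)].
  by move=> Dp; apply: chain_rounded_ideal => // i; case: (nE p i Dp).
pose I p (Dp : D p) : RI R := exist _ _ (nI p Dp).
have QI p (Dp : D p) : names (RI R) (Q p) (I p Dp).
  move=> x; split=> [[i /eR[j ej]]|[t]].
    by exists (cpair j i); rewrite /Q !(cfstK, csndK) ej /= cfstK csndK eqxx.
  rewrite /Q; case et: (e (cfst t)) => [//|y] /=; case: eqP => // yn [yx].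
  exists (csnd t); apply/eR; exists (cfst t).
  by rewrite et -yn -yx cpairK.
have gA p (A : overt X) (Dp : D p) : names (overt X) p A -> sval A (g (I p Dp)).
  move=> pA; apply: contrapT => nA.
  (* The complement of [A] is pulled back along [g] to an open set of ideals, of which a basic
     neighbourhood given by [z] is taken. *)
  have := open_preimage hg (svalP A) => /(RI_open_basis Rtr)/(_ nA).
  move=> [z [[i zi] zA]].
  have [/(VA p A pA)[x [Ix Ax]] _] := nE p i Dp.
  (* The point [x] of [A] has [n p i], hence also [z], in [f x]; so [g (f x)], which is [x], would
     lie outside [A]. *)
  apply: (zA (f x)); last by rewrite fK.
  by have [_ down _] := svalP (f x); exact: down zi.
pose T p := Tg (Q p).
have [c hc] : computable_on D T.
  apply: computable_on_subst hTg hQ _ => p Dp.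
  by exists (I p Dp); exact: QI.
exists (fun p => if `[< D p >] then Some (T p) else None); last first.
  by exists c => p q; case: asboolP => // Dp [<-]; exact: hc.
move=> p A pA A0; have Dp : D p by exists A.
exists (T p), (g (I p Dp)); rewrite asboolT //; split=> //.
  exact/Tg_names/QI.
exact: gA.
Qed.
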